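(* Every finite dimensional C$^*$-algebra has property $\mathrm{(co)}$.
   Context: For a Banach space $X$, $B_X$ is the closed unit ball and $B(x,r)$ is the ball of centre $x$ and radius $r$. $X$ has property $\mathrm{(co)}$ if for every $n\in\mathbb{N}$, all $x_1,\dots,x_n\in B_X$, all $\lambda_1,\dots,\lambda_n>0$ with $\sum_{i=1}^n\lambda_i=1$ and every $\varepsilon>0$, there exist $\delta>0$ and continuous functions $\Phi_i:B(x_0,\delta)\cap B_X\to B(x_i,\varepsilon)\cap B_X$ ($i=1,\dots,n$), where $x_0=\sum_{i=1}^n\lambda_i x_i$, such that $y=\sum_{i=1}^n\lambda_i\Phi_i(y)$ for every $y\in B(x_0,\delta)\cap B_X$. *)

(* Defs.v *)
From HB Require Import structures.
From mathcomp Require Import all_boot all_order all_algebra.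
From mathcomp Require Import complex.
From mathcomp Require Import all_classical all_reals all_analysis.

Set Implicit Arguments.
Unset Strict Implicit.
Unset Printing Implicit Defensive.

Import Order.TTheory GRing.Theory Num.Theory.
Import numFieldNormedType.Exports.

Local Open Scope classical_set_scope.
Local Open Scope ring_scope.

Definition unit_ball (K : numFieldType) (X : normedModType K) : set X :=
  [set x | `|x| <= 1].
Arguments unit_ball {K} X.

(* [K] covers the real and the complex scalars at once: in [R[i]], the order
   is partial and [0 < z] holds exactly when [z] is real and positive.
   [ball x r] is the open ball; since [delta] and [eps] are arbitrary, closed
   balls would give the same property. *)
Definition property_co (K : numFieldType) (X : completeNormedModType K) : Prop :=
  forall (n : nat) (x : 'I_n -> X) (lambda : 'I_n -> K) (eps : K),
    (forall i, unit_ball X (x i)) ->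
    (forall i, 0 < lambda i) ->
    \sum_(i < n) lambda i = 1 ->
    0 < eps ->
    let x0 := \sum_(i < n) lambda i *: x i in
    exists (delta : K) (Phi : 'I_n -> X -> X),
      [/\ 0 < delta,
          forall i, {within ball x0 delta `&` unit_ball X, continuous (Phi i)},
          forall i y, (ball x0 delta `&` unit_ball X) y ->
            (ball (x i) eps `&` unit_ball X) (Phi i y) &
          forall y, (ball x0 delta `&` unit_ball X) y ->
            y = \sum_(i < n) lambda i *: Phi i y].

(* The product is a bare operation because the ring structures of the library
   are unital, while a C*-algebra need not have a unit. *)
HB.mixin Record CompleteNormedModule_isCStarAlgebra (R : realType) (A : Type)
    of CompleteNormedModule R[i] A := {
  cstar_mul : A -> A -> A;
  cstar_adj : A -> A;
  cstar_mulA : associative cstar_mul;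
  cstar_mulDl : left_distributive cstar_mul +%R;
  cstar_mulDr : right_distributive cstar_mul +%R;
  cstar_mulZl : forall (c : R[i]) (a b : A),
    cstar_mul (c *: a) b = c *: cstar_mul a b;
  cstar_mulZr : forall (c : R[i]) (a b : A),
    cstar_mul a (c *: b) = c *: cstar_mul a b;
  cstar_adjK : involutive cstar_adj;
  cstar_adjD : {morph cstar_adj : a b / a + b};
  cstar_adjZ : forall (c : R[i]) (a : A),
    cstar_adj (c *: a) = c^* *: cstar_adj a;
  cstar_adjM : forall a b : A,
    cstar_adj (cstar_mul a b) = cstar_mul (cstar_adj b) (cstar_adj a);
  cstar_normM : forall a b : A, `|cstar_mul a b| <= `|a| * `|b|;
  cstar_norm_adjM : forall a : A, `|cstar_mul (cstar_adj a) a| = `|a| ^+ 2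
}.

#[short(type="cstarAlgType")]
HB.structure Definition CStarAlgebra (R : realType) :=
  {A of CompleteNormedModule_isCStarAlgebra R A & CompleteNormedModule R[i] A}.

Definition finite_dimensional (K : fieldType) (V : lmodType K) : Prop :=
  exists n : nat, inhabited (Vector.axiom n V).

(* Main.v *)
(* The trace [tau] of the left regular representation of [A] satisfies
   [4 tau (a^# a) = tau (u u) + tau (v v)] with [u = a + a^#] and
   [v = i (a - a^#)] self-adjoint, and the square of a self-adjoint element has
   nonnegative eigenvalues; so [(a, b) |-> tau (b^# a)] is an inner product, left
   multiplication by [a^#] is the adjoint of left multiplication by [a], and the
   unit ball of [A] consists of the elements acting as contractions.

   Put [Q y = 1 - y^# y] and [P y = 1 - y y^#]. On the kernel of [Q x0], where
   [x0] is isometric, strict convexity forces [x_i = x0], and likewise for the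
   adjoints; hence [x_i - x0 = P x0 w_i Q x0] for some [w_i], and the unique
   normalised choice of the [w_i] satisfies [sum lambda_i w_i = 0]. For [s < 1]
   close to 1 take [Phi_i y = y + s P y w_i Q y]: the average of the [Phi_i y] is
   [y], the [Phi_i] are polynomials in [y] and [y^#], and since [P y] and [Q y]
   vanish wherever [y] or [y^#] is isometric, [Phi_i y] remains a contraction for
   every [y] of the unit ball close to [x0]. *)

From HB Require Import structures.
Require Import Defs.
From mathcomp Require Import all_boot all_order all_algebra.
From mathcomp Require Import complex ring lra.
From mathcomp Require Import all_classical all_reals all_analysis.

Set Implicit Arguments.
Unset Strict Implicit.
Unset Printing Implicit Defensive.

Import Order.TTheory GRing.Theory Num.Theory.
Import numFieldNormedType.Exports.

Local Open Scope classical_set_scope.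
Local Open Scope ring_scope.

Local Notation "a ** b" := (cstar_mul a b) (at level 40, left associativity).
Local Notation "a ^#" := (cstar_adj a).
Local Notation normc := ComplexField.Normc.normc.
Local Notation Re := complex.Re.

(** * Eigenvalues of matrices and real inequalities *)

Lemma mxtrace_eigenvalues (F : closedFieldType) n (M : 'M[F]_n) :
  exists s : seq F, [/\ size s = n, \tr M = \sum_(z <- s) z,
    char_poly M = \prod_(z <- s) ('X - z%:P) &
    {in s, forall z, eigenvalue M z}].
Proof.
have [s] := closed_field_poly_normal (char_poly M).
rewrite (monicP (char_poly_monic M)) scale1r => Ms.
have sz : size s = n.
  by apply: succn_inj; rewrite -(size_char_poly M) Ms size_prod_XsubC.
exists s; split => //; last first.
  by move=> z zs; rewrite eigenvalue_root_char Ms root_prod_XsubC.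
(* The trace is read off the coefficient of degree [n - 1], so size 0 is treated apart. *)
have [n0|n0] := posnP n.
  have s0 : s = [::] by apply: size0nil; rewrite sz.
  by rewrite s0 big_nil; clear Ms sz s0; subst n; rewrite /mxtrace big_ord0.
apply: oppr_inj; rewrite -(char_poly_trace M n0) Ms -{1}sz coefPn_prod_XsubC //.
by rewrite sz -lt0n.
Qed.

(** Cayley-Hamilton, the characteristic polynomial being a power of ['X]. *)
Lemma nilpotent_eigenvalue0 (F : closedFieldType) n (M : 'M[F]_n) :
  (forall z, eigenvalue M z -> z = 0) ->
  exists m, forall u : 'rV_n, iter m (mulmxr M) u = 0.
Proof.
case: n M => [|n] M M0; first by exists 0%N => u /=; rewrite [u]thinmx0.
exists n.+1 => u; suff -> m : iter m (mulmxr M) u = u *m M ^+ m.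
  have [s [sz _ Ms sM]] := mxtrace_eigenvalues M.
  have := Cayley_Hamilton M; rewrite Ms big_seq.
  rewrite (eq_bigr (fun=> 'X)); last by move=> z /sM /M0 ->; rewrite subr0.
  rewrite -big_seq big_const_seq count_predT sz iter_mulr_1 rmorphXn /=.
  by rewrite horner_mx_X => ->; rewrite mulmx0.
elim: m => [|m IH]; first by rewrite expr0 mulmx1.
by rewrite iterS IH /= -mulmxA exprSr.
Qed.

(* Plays the role of the spectral radius formula: it is applied to
   [|h^m b|^2] and to [nrm h^m] for a self-adjoint [h]. *)
Lemma logconvex_bounded (R : realType) (u : nat -> R) (B : R) :
  (forall m, 0 <= u m) -> (forall m, u m <= B) ->
  (forall m, u m.+1 ^+ 2 <= u m * u m.+2) -> u 1%N <= u 0%N.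
Proof.
move=> u0 uB ul; rewrite leNgt; apply/negP => u01.
have u0p : 0 < u 0%N.
  rewrite lt0r u0 andbT; apply/eqP => u00.
  by have := ul 0%N; rewrite u00 mul0r leNgt exprn_gt0 // (le_lt_trans _ u01).
have dp : 0 < u 1%N - u 0%N by rewrite subr_gt0.
(* Log-convexity makes the increments nondecreasing, so [u] grows at least linearly, against the
   bound [B]. *)
have gr m : [/\ 0 < u m, u 0%N + m%:R * (u 1%N - u 0%N) <= u m &
    u 1%N - u 0%N <= u m.+1 - u m].
  elim: m => [|m [um IH1 IH2]]; first by rewrite mul0r addr0.
  have um1 : 0 < u m.+1.
    by apply: (lt_le_trans um); rewrite -subr_ge0; apply: le_trans IH2; exact: ltW.
  split=> //.
    rewrite -[m.+1%:R]natr1 mulrDl mul1r addrA.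
    by rewrite -[u m.+1](subrK (u m)) [u m.+1 - _ + _]addrC lerD.
  apply: le_trans IH2 _.
  suff : 0 <= u m * (u m.+2 - u m.+1 - (u m.+1 - u m)) by rewrite pmulr_rge0 // subr_ge0.
  have := ul m; have := sqr_ge0 (u m.+1 - u m); lra.
pose m := Num.truncn (B / (u 1%N - u 0%N)).
have [_ + _] := gr m.+1; apply/negP; rewrite -ltNge.
apply: le_lt_trans (uB _) _.
rewrite -ltrBlDl; apply: (@lt_trans _ _ B); first by rewrite ltrBlDl ltrDr.
rewrite -ltr_pdivrMr //; exact: truncnS_gt.
Qed.

(** Source of Cauchy-Schwarz, both for [ip] and for the possibly degenerate form of [defect]. *)
Lemma quadratic_discr (R : realType) (x y z : R) : 0 <= z ->
  (forall t, 0 <= x + 2 * t * y + t ^+ 2 * z) -> y ^+ 2 <= x * z.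
Proof.
move=> z0 h; have [z00|zn0] := eqVneq z 0.
  have [->|yn0] := eqVneq y 0; first by rewrite z00 expr0n mulr0.
  (* For [z = 0] the polynomial is affine in [t], and this [t] gives it the value -1. *)
  have := h (- (x + 1) / (2 * y)); rewrite z00 mulr0 addr0.
  have -> : x + 2 * (- (x + 1) / (2 * y)) * y = - 1 by field.
  by rewrite ler0N1.
have zp : 0 < z by rewrite lt0r zn0.
have := h (- y / z).
have -> : x + 2 * (- y / z) * y + (- y / z) ^+ 2 * z = (x * z - y ^+ 2) / z by field.
by rewrite pmulr_lge0 ?invr_gt0 // subr_ge0.
Qed.

Lemma sqr_near (R : realType) (p q r k : R) : 0 <= q -> 0 <= r -> q <= p ->
  r <= p -> 0 <= k -> q <= r + k -> q ^+ 2 <= r ^+ 2 + 2 * k * p.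
Proof.
move=> q0 r0 qp rp k0 qr.
have : 0 <= (r + k - q) * (q + r) by apply: mulr_ge0; rewrite ?subr_ge0 // addr_ge0.
have : 0 <= k * ((p - q) + (p - r)) by rewrite mulr_ge0 // addr_ge0 // subr_ge0.
lra.
Qed.

Lemma normc_ge0 (R : realType) (z : R[i]) : 0 <= normc z.
Proof. by rewrite -ler0c; exact: (normr_ge0 z). Qed.

Lemma normcR (R : realType) (k : R) : normc k%:C%C = `|k|.
Proof. by rewrite /= expr0n addr0 sqrtr_sqr. Qed.

Lemma normc_sum (R : realType) (I : Type) (s : seq I) (F : I -> R[i]) :
  normc (\sum_(i <- s) F i) <= \sum_(i <- s) normc (F i).
Proof.
rewrite -lecR rmorph_sum; exact: (ler_norm_sum s F xpredT).
Qed.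

(** * Elementary consequences of the C*-identity *)

Section CStarBasics.
Variables (R : realType) (A : cstarAlgType R).
Implicit Types a b c : A.
Local Notation C := R[i].

Lemma cstar_mul_linear a : linear (cstar_mul a).
Proof. by move=> k b c; rewrite cstar_mulDr cstar_mulZr. Qed.

HB.instance Definition _ a :=
  @GRing.isLinear.Build C A A *:%R (cstar_mul a) (cstar_mul_linear a).

Lemma cstar_mul0 a : a ** 0 = 0. Proof. exact: raddf0. Qed.

Lemma cstar_0mul a : 0 ** a = 0.
Proof. by rewrite -(scale0r (0 : A)) cstar_mulZl !scale0r. Qed.

Lemma cstar_mulNr a b : a ** (- b) = - (a ** b). Proof. exact: raddfN. Qed.

Lemma cstar_mulNl a b : (- a) ** b = - (a ** b).
Proof. by rewrite -scaleN1r cstar_mulZl scaleN1r. Qed.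

Lemma cstar_mulBr a b c : a ** (b - c) = a ** b - a ** c.
Proof. exact: raddfB. Qed.

Lemma cstar_mulBl a b c : (a - b) ** c = a ** c - b ** c.
Proof. by rewrite cstar_mulDl cstar_mulNl. Qed.

Lemma cstar_adj0 : (0 : A)^# = 0.
Proof. by rewrite -(scale0r (0 : A)) cstar_adjZ conjC0 !scale0r. Qed.

Lemma cstar_adjN a : (- a)^# = - a^#.
Proof. by apply/eqP; rewrite -addr_eq0 -cstar_adjD addNr cstar_adj0. Qed.

Lemma cstar_adjB a b : (a - b)^# = a^# - b^#.
Proof. by rewrite cstar_adjD cstar_adjN. Qed.

(** The norm of [A] takes values in [R[i]]; this is the same number in the ordered field [R]. *)
Definition nrm a : R := Re `|a|.

Lemma nrmE a : `|a| = (nrm a)%:C%C.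
Proof. by have /ger0_Im := normr_ge0 a; rewrite /nrm; case: `|a| => x y /= ->. Qed.

Lemma nrm_ge0 a : 0 <= nrm a.
Proof. by have := normr_ge0 a; rewrite nrmE ler0c. Qed.

Lemma nrm0P a : nrm a = 0 -> a = 0.
Proof. by move=> a0; apply/eqP; rewrite -normr_eq0 nrmE a0. Qed.

Lemma nrmD a b : nrm (a + b) <= nrm a + nrm b.
Proof. by rewrite -lecR rmorphD /= -!nrmE; exact: ler_normD. Qed.

Lemma nrmZ (k : C) a : nrm (k *: a) = normc k * nrm a.
Proof. by apply: complexI; rewrite rmorphM /= -!nrmE normrZ. Qed.

Lemma nrmN a : nrm (- a) = nrm a.
Proof. by rewrite /nrm normrN. Qed.

Lemma nrmM a b : nrm (a ** b) <= nrm a * nrm b.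
Proof. by rewrite -lecR rmorphM /= -!nrmE; exact: cstar_normM. Qed.

Lemma nrm_adjM a : nrm (a^# ** a) = nrm a ^+ 2.
Proof. by apply: complexI; rewrite rmorphXn /= -!nrmE cstar_norm_adjM. Qed.

(** The C*-identity and submultiplicativity give [|b|^2 <= |b^#| |b|]; cancel [|b|], then exchange
    [b] and [b^#]. *)
Lemma nrm_adj a : nrm a^# = nrm a.
Proof.
have le b : nrm b <= nrm b^#.
  have [->|b0] := eqVneq (nrm b) 0; first exact: nrm_ge0.
  have := nrmM b^# b; rewrite nrm_adjM expr2 ler_pM2r //.
  by rewrite lt0r b0 nrm_ge0.
by apply/eqP; rewrite eq_le le -{2}[a]cstar_adjK le.
Qed.

Lemma nrm_sqr a : a^# = a -> nrm (a ** a) = nrm a ^+ 2.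
Proof. by move=> ah; rewrite -nrm_adjM ah. Qed.

Lemma cstar_adjM_eq0 a : a^# ** a = 0 -> a = 0.
Proof.
move=> aa; apply: nrm0P; apply/eqP; rewrite -sqrf_eq0 -nrm_adjM aa.
by rewrite /nrm normr0.
Qed.

End CStarBasics.

(** * Powers of an element *)

Section Powers.
Variables (R : realType) (A : cstarAlgType R).
Implicit Types a b c : A.

(* The exponent is [m.+1]: [A] need not have a unit. *)
Definition cpow a m : A := iter m (cstar_mul a) a.

Lemma cpowM a m k : cpow a m ** cpow a k = cpow a (m + k).+1.
Proof.
elim: m => [|m IH] //.
by rewrite /cpow iterS -cstar_mulA -/(cpow a m) -/(cpow a k) IH.
Qed.

Lemma cpow_adj a m : a^# = a -> (cpow a m)^# = cpow a m.
Proof.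
move=> ah; elim: m => [|m IH] //.
by rewrite {1}/cpow iterS cstar_adjM -/(cpow a m) IH ah -{2}[a]/(cpow a 0) cpowM addn0.
Qed.

(** The square of the self-adjoint element [cpow a m] is a multiple of [cpow a m.+1]; if the latter
    vanishes, the C*-identity kills [cpow a m], and the exponent descends. *)
Lemma cpow_eq0 a m : a^# = a -> cpow a m = 0 -> a = 0.
Proof.
move=> ah; elim: m => [|m IH] // a0; apply/IH/cstar_adjM_eq0.
rewrite (cpow_adj _ ah) cpowM -addSn addnC; move: {1}m => k.
by elim: k => [|k IHk] //; rewrite addSn /cpow iterS -/(cpow _ _) IHk cstar_mul0.
Qed.

Lemma iter_cstar_mul a b m : iter m.+1 (cstar_mul a) b = cpow a m ** b.
Proof. by elim: m => [|m IH] //; rewrite iterS IH cstar_mulA. Qed.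

Lemma cpow_nrm a m : nrm a <= 1 -> nrm (cpow a m) <= 1.
Proof.
move=> a1; elim: m => [|m IH] //; apply: le_trans (nrmM _ _) _.
by rewrite -/(cpow a m) mulr_ile1 ?nrm_ge0.
Qed.

End Powers.

(** * The trace of the regular representation *)

(** A choice of coordinates kept as data, so that matrices and traces can be defined from it. *)
Record coordinates (R : realType) (A : cstarAlgType R) := Coordinates {
  dim : nat;
  to_row : {linear A -> 'rV[R[i]]_dim};
  of_row : {linear 'rV[R[i]]_dim -> A};
  to_rowK : cancel to_row of_row;
  of_rowK : cancel of_row to_row
}.

Section Trace.
Variables (R : realType) (A : cstarAlgType R) (cs : coordinates A).
Local Notation C := R[i].
Local Notation n := (dim cs).
Local Notation v2r := (to_row cs).
Local Notation r2v := (of_row cs).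
Local Notation v2rK := (@to_rowK _ _ cs).
Local Notation r2vK := (@of_rowK _ _ cs).
Implicit Types a b c : A.

Definition mxof (f : {linear A -> A}) : 'M[C]_n := lin1_mx (v2r \o f \o r2v).

Lemma mul_mxof (f : {linear A -> A}) b : v2r b *m mxof f = v2r (f b).
Proof. by rewrite mul_rV_lin1 /= v2rK. Qed.

Lemma mxof_inj (M N : 'M[C]_n) :
  (forall b, v2r b *m M = v2r b *m N) -> M = N.
Proof.
by move=> MN; apply/row_matrixP => i; rewrite !rowE -[delta_mx _ _]r2vK MN.
Qed.

Lemma mxof_eigenvalue (f : {linear A -> A}) z :
  eigenvalue (mxof f) z -> exists2 b, f b = z *: b & b != 0.
Proof.
case/eigenvalueP => u uz u0; exists (r2v u).
  by apply: (can_inj v2rK); rewrite -mul_mxof linearZ /= r2vK.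
by apply: contra_neq u0 => u0; rewrite -[u]r2vK u0 linear0.
Qed.

Definition tau a : C := \tr (mxof (cstar_mul a)).

Lemma tau_linear : linear_for *%R tau.
Proof.
move=> k a b; rewrite /tau.
suff -> : mxof (cstar_mul (k *: a + b)) =
    k *: mxof (cstar_mul a) + mxof (cstar_mul b) by rewrite mxtraceD mxtraceZ.
apply: mxof_inj => c; rewrite mulmxDr -scalemxAr !mul_mxof.
by rewrite /= cstar_mulDl cstar_mulZl linearP.
Qed.

HB.instance Definition _ := @GRing.isLinear.Build C A C *%R tau tau_linear.

Lemma tauD a b : tau (a + b) = tau a + tau b. Proof. exact: linearD. Qed.

Lemma tauN a : tau (- a) = - tau a. Proof. exact: linearN. Qed.

Lemma tauZ k a : tau (k *: a) = k * tau a. Proof. exact: linearZ. Qed.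

Lemma tauC a b : tau (a ** b) = tau (b ** a).
Proof.
(* Matrices act on row vectors, hence the reversed order. *)
suff mM c d : mxof (cstar_mul (c ** d)) = mxof (cstar_mul d) *m mxof (cstar_mul c).
  by rewrite /tau !mM mxtrace_mulC.
by apply: mxof_inj => e; rewrite mulmxA !mul_mxof /= cstar_mulA.
Qed.

Lemma eigenvalue_le a z : eigenvalue (mxof (cstar_mul a)) z -> `|z| <= `|a|.
Proof.
case/mxof_eigenvalue => b ab b0; rewrite -(ler_pM2r (_ : 0 < `|b|)) ?normr_gt0 //.
by rewrite -normrZ -ab cstar_normM.
Qed.

(** The argument for Hermitian operators, with the [A]-valued product [b^# ** c] as inner
    product. *)
Lemma eigenvalue_real a z : a^# = a ->
  eigenvalue (mxof (cstar_mul a)) z -> z \is Num.real.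
Proof.
move=> ah /mxof_eigenvalue[b ab b0].
have e1 : b^# ** (a ** b) = z *: (b^# ** b) by rewrite ab cstar_mulZr.
have e2 : b^# ** (a ** b) = z^* *: (b^# ** b).
  by rewrite cstar_mulA -{1}ah -cstar_adjM ab cstar_adjZ cstar_mulZl.
apply/CrealP/eqP; rewrite -subr_eq0; apply: contraNT b0 => zz.
apply/eqP/cstar_adjM_eq0/eqP; move: (eqxx (b^# ** (a ** b))).
by rewrite {1}e2 e1 -subr_eq0 -scalerBl scaler_eq0 (negPf zz).
Qed.

(** Let [r = sqrtC z]. From [(a - r)(a + r) b = 0], either [(a + r) b] is an eigenvector of [a] for
    [r], or [b] is one for [- r]; so [r] is real. *)
Lemma eigenvalue_sqr_ge0 a z : a^# = a ->
  eigenvalue (mxof (cstar_mul (a ** a))) z -> 0 <= z.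
Proof.
move=> ah /mxof_eigenvalue[b ab b0].
suff : sqrtC z \is Num.real by rewrite realEsqr sqrtCK.
have [c0|c0] := eqVneq (a ** b + sqrtC z *: b) 0; last first.
  apply: (@eigenvalue_real a) => //; apply/eigenvalueP.
  exists (v2r (a ** b + sqrtC z *: b)).
    rewrite mul_mxof -linearZ /=; congr (v2r _).
    by rewrite cstar_mulDr cstar_mulA ab cstar_mulZr scalerDr scalerA -expr2 sqrtCK addrC.
  by apply: contra_neq c0 => c0; rewrite -[LHS]v2rK c0 linear0.
rewrite -realN; apply: (@eigenvalue_real a) => //; apply/eigenvalueP.
exists (v2r b); last by apply: contra_neq b0 => b0; rewrite -[LHS]v2rK b0 linear0.
rewrite mul_mxof -linearZ /=; congr (v2r _).
by apply/eqP; rewrite scaleNr -addr_eq0 c0.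
Qed.

Lemma tau_real a : a^# = a -> tau a \is Num.real.
Proof.
move=> ah; rewrite /tau; have [s [_ -> _ sM]] := mxtrace_eigenvalues (mxof (cstar_mul a)).
by rewrite big_seq rpred_sum // => z /sM /eigenvalue_real; exact.
Qed.

Lemma tau_le a : `|tau a| <= n%:R * `|a|.
Proof.
rewrite /tau; have [s [sz -> _ sM]] := mxtrace_eigenvalues (mxof (cstar_mul a)).
rewrite big_seq; apply: le_trans (ler_norm_sum _ _ _) _.
apply: (@le_trans _ _ (\sum_(z <- s | z \in s) `|a|)).
  by apply: ler_sum => z /sM /eigenvalue_le.
by rewrite -big_seq big_const_seq count_predT iter_addr_0 sz mulr_natl.
Qed.

Lemma tau_sqr_ge0 a : a^# = a -> 0 <= tau (a ** a).
Proof.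
move=> ah; rewrite /tau.
have [s [_ -> _ sM]] := mxtrace_eigenvalues (mxof (cstar_mul (a ** a))).
by rewrite big_seq sumr_ge0 // => z /sM /eigenvalue_sqr_ge0; exact.
Qed.

(** Nonnegative eigenvalues with sum zero all vanish, so [a ** a] acts nilpotently, and a
    self-adjoint nilpotent element is zero. *)
Lemma tau_sqr_eq0 a : a^# = a -> tau (a ** a) = 0 -> a = 0.
Proof.
move=> ah; rewrite /tau.
have [s [_ -> Ms sM]] := mxtrace_eigenvalues (mxof (cstar_mul (a ** a))).
rewrite big_seq => /eqP; rewrite psumr_eq0; last first.
  by move=> z /sM /eigenvalue_sqr_ge0; exact.
move=> /allP s0; have {}s0 z : eigenvalue (mxof (cstar_mul (a ** a))) z -> z = 0.
  rewrite eigenvalue_root_char Ms root_prod_XsubC => zs.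
  by have := s0 _ zs; rewrite zs => /eqP.
have [m mP] := nilpotent_eigenvalue0 s0.
have hh : (a ** a)^# = a ** a by rewrite cstar_adjM ah.
suff /(cpow_eq0 hh) : cpow (a ** a) m = 0.
  by move=> aa0; apply: cstar_adjM_eq0; rewrite ah.
(* The vanishing iterate is evaluated at [a ** a] itself, in the absence of a unit. *)
rewrite -[LHS]v2rK -(linear0 r2v) -(mP (v2r (a ** a))); congr (r2v _).
elim: m {mP} => [|m IH] //; first by rewrite /= -IH /= mul_mxof.
Qed.

(** [tau] is real at the self-adjoint elements [a + a^#] and ['i *: (a - a^#)]; solve the two
    equations. *)
Lemma tau_adj a : tau a^# = (tau a)^*.
Proof.
have r1 : tau (a + a^#) \is Num.real.
  by apply: tau_real; rewrite cstar_adjD cstar_adjK addrC.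
have r2 : tau ('i *: (a - a^#)) \is Num.real.
  apply: tau_real; rewrite cstar_adjZ conjCi cstar_adjB cstar_adjK.
  by rewrite scaleNr -scalerN opprB.
move: r1 r2; rewrite linearD linearZ linearB /= => /CrealP + /CrealP.
rewrite rmorphM rmorphD rmorphB /= conjCi => e1.
rewrite mulNr -mulrN => /(mulfI (neq0Ci _)); rewrite opprB => e2.
apply/esym/(@mulfI _ 2); rewrite ?pnatr_eq0 //.
have -> : 2 * (tau a)^* = (tau a)^* + (tau a^#)^* - ((tau a^#)^* - (tau a)^*) by ring.
by rewrite e1 e2; ring.
Qed.

Lemma tau_adjM4 a : let u := a + a^# in let v := 'i *: (a - a^#) in
  [/\ u^# = u, v^# = v & 4 * tau (a^# ** a) = tau (u ** u) + tau (v ** v)].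
Proof.
move=> u v; split.
- by rewrite cstar_adjD cstar_adjK addrC.
- by rewrite cstar_adjZ conjCi cstar_adjB cstar_adjK scaleNr -scalerN opprB.
rewrite /v cstar_mulZl cstar_mulZr scalerA -expr2 sqrCi scaleN1r.
rewrite /u !cstar_mulDl !cstar_mulDr !cstar_mulNl !cstar_mulNr.
rewrite !(tauN, tauD) (tauC a a^#); ring.
Qed.

Lemma tau_adjM_ge0 a : 0 <= tau (a^# ** a).
Proof.
have [uh vh e] := tau_adjM4 a; rewrite -(pmulr_rge0 _ (ltr0n _ 4)) e.
by rewrite addr_ge0 // tau_sqr_ge0.
Qed.

Lemma tau_adjM_eq0 a : tau (a^# ** a) = 0 -> a = 0.
Proof.
have [uh vh e] := tau_adjM4 a => a0; move: e; rewrite a0 mulr0 => /esym/eqP.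
rewrite paddr_eq0 ?tau_sqr_ge0 // => /andP[/eqP/(tau_sqr_eq0 uh) u0].
move=> /eqP/(tau_sqr_eq0 vh)/eqP; rewrite scaler_eq0 (negPf (neq0Ci _)) /=.
rewrite subr_eq0 => /eqP aa; apply/eqP; move/eqP: u0; rewrite -aa -mulr2n.
by rewrite -scaler_nat scaler_eq0 pnatr_eq0.
Qed.

End Trace.

(** * The inner product of the trace *)

Section InnerProduct.
Variables (R : realType) (A : cstarAlgType R) (cs : coordinates A).
Local Notation C := R[i].
Local Notation n := (dim cs).
Local Notation v2r := (to_row cs).
Local Notation r2v := (of_row cs).
Local Notation v2rK := (@to_rowK _ _ cs).
Local Notation r2vK := (@of_rowK _ _ cs).
Implicit Types a b c : A.

Local Notation tau := (tau cs).

(** The real part makes this a symmetric form over [R]; the imaginary part is recovered by replacing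
    [a] with ['i *: a]. *)
Definition ip a b : R := Re (tau (b^# ** a)).

Lemma ipC a b : ip a b = ip b a.
Proof.
rewrite /ip -[b^# ** a]cstar_adjK tau_adj cstar_adjM cstar_adjK.
by case: (tau _).
Qed.

Lemma ipDl a b c : ip (a + b) c = ip a c + ip b c.
Proof. by rewrite /ip cstar_mulDr tauD // raddfD. Qed.

Lemma ipNl a c : ip (- a) c = - ip a c.
Proof. by rewrite /ip cstar_mulNr tauN // raddfN. Qed.

Lemma ipBl a b c : ip (a - b) c = ip a c - ip b c.
Proof. by rewrite ipDl ipNl. Qed.

Lemma ipDr a b c : ip c (a + b) = ip c a + ip c b.
Proof. by rewrite !(ipC c) ipDl. Qed.

Lemma ipNr a c : ip c (- a) = - ip c a.
Proof. by rewrite !(ipC c) ipNl. Qed.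

Lemma ipBr a b c : ip c (a - b) = ip c a - ip c b.
Proof. by rewrite !(ipC c) ipBl. Qed.

Lemma ipZl (k : R) a b : ip (k%:C%C *: a) b = k * ip a b.
Proof.
rewrite /ip cstar_mulZr tauZ //; case: (tau _) => x y /=.
by rewrite mul0r subr0.
Qed.

Lemma ipZr (k : R) a b : ip a (k%:C%C *: b) = k * ip a b.
Proof. by rewrite ipC ipZl ipC. Qed.

Lemma ipMl a b c : ip (c ** a) b = ip a (c^# ** b).
Proof. by rewrite /ip cstar_adjM cstar_adjK cstar_mulA. Qed.

Lemma ipMr a b c : ip a (c ** b) = ip (c^# ** a) b.
Proof. by rewrite ipMl cstar_adjK. Qed.

Lemma ip_sqrD a b : ip (a + b) (a + b) = ip a a + 2 * ip a b + ip b b.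
Proof. by rewrite ipDl !ipDr (ipC b a); ring. Qed.

Lemma ip0r a : ip a 0 = 0.
Proof. by rewrite -(subrr 0) ipBr subrr. Qed.

Lemma ip0l a : ip 0 a = 0. Proof. by rewrite ipC ip0r. Qed.

Lemma ip_ge0 a : 0 <= ip a a.
Proof.
have := tau_adjM_ge0 cs a; rewrite /ip; case: (tau _) => x y.
by rewrite lecE /= => /andP[].
Qed.

Lemma ip_eq0 a : ip a a = 0 -> a = 0.
Proof.
move=> a0; apply: (@tau_adjM_eq0 _ _ cs); have := tau_adjM_ge0 cs a.
move: a0; rewrite /ip; case: (tau _) => x y /= ->.
by rewrite lecE /= => /andP[/eqP ->].
Qed.

Definition hn a : R := Num.sqrt (ip a a).

Lemma hn_ge0 a : 0 <= hn a. Proof. exact: sqrtr_ge0. Qed.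

Lemma hn_sqr a : hn a ^+ 2 = ip a a. Proof. by rewrite sqr_sqrtr ?ip_ge0. Qed.

Lemma ip_CS a b : `|ip a b| <= hn a * hn b.
Proof.
rewrite -(@ler_pXn2r _ 2) ?nnegrE ?mulr_ge0 ?hn_ge0 //.
rewrite real_normK ?num_real // exprMn !hn_sqr.
apply: (quadratic_discr (ip_ge0 b)) => t.
have := ip_ge0 (a + t%:C%C *: b).
rewrite ip_sqrD ipZr ipZl ipZr; lra.
Qed.

Lemma ip_le a b : ip a b <= hn a * hn b.
Proof. exact: le_trans (ler_norm _) (ip_CS _ _). Qed.

Lemma hnD a b : hn (a + b) <= hn a + hn b.
Proof.
rewrite -(@ler_pXn2r _ 2) ?nnegrE ?addr_ge0 ?hn_ge0 //.
rewrite hn_sqr ip_sqrD sqrrD !hn_sqr.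
have := ip_le a b; lra.
Qed.

Lemma hn_le a b : (hn a <= hn b) = (ip a a <= ip b b).
Proof. by rewrite /hn ler_sqrt ?ip_ge0. Qed.

Lemma hn0 : hn 0 = 0.
Proof. by rewrite /hn /ip cstar_mul0 /= raddf0 sqrtr0. Qed.

Lemma hnN a : hn (- a) = hn a.
Proof. by rewrite /hn ipNl ipNr opprK. Qed.

Lemma ipZZ (z : C) a : ip (z *: a) (z *: a) = normc z ^+ 2 * ip a a.
Proof.
rewrite /ip cstar_adjZ cstar_mulZr cstar_mulZl scalerA -normCK tauZ //.
have -> : `|z| = (normc z)%:C%C by [].
by rewrite -rmorphXn /=; case: (tau _) => x y /=; rewrite mul0r subr0.
Qed.

Lemma hnZ (z : C) a : hn (z *: a) = normc z * hn a.
Proof.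
by rewrite /hn ipZZ sqrtrM ?sqr_ge0 // sqrtr_sqr ger0_norm ?normc_ge0.
Qed.

Lemma hn_bound b : ip b b <= n%:R * nrm b ^+ 2.
Proof.
have := tau_le cs (b^# ** b); rewrite ger0_norm ?tau_adjM_ge0 //.
rewrite nrmE nrm_adjM /ip -[n%:R](rmorph_nat (real_complex R)) -rmorphM /=.
by rewrite lecE /= => /andP[].
Qed.

(** With [h = a^# ** a] self-adjoint, Cauchy-Schwarz makes [|h^m b|^2] log-convex in [m], and
    [hn_bound] bounds it, so [|h b| <= |b|]. Then [|a b|^2 = <b, h b> <= |b|^2]. *)
Lemma contraction_hn a b : nrm a <= 1 -> hn (a ** b) <= hn b.
Proof.
move=> a1; pose h := a^# ** a.
have hh : h^# = h by rewrite cstar_adjM cstar_adjK.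
have h1 : nrm h <= 1 by rewrite nrm_adjM expr_le1 ?nrm_ge0.
have hb : ip (h ** b) (h ** b) <= ip b b.
  pose u m := ip (iter m (cstar_mul h) b) (iter m (cstar_mul h) b).
  apply: (@logconvex_bounded _ u (n%:R * nrm b ^+ 2)) => m; rewrite /u.
  - exact: ip_ge0.
  - apply: le_trans (hn_bound _) _; rewrite ler_wpM2l // ler_pXn2r ?nnegrE ?nrm_ge0 //.
    case: m => [|m] //; rewrite iter_cstar_mul; apply: le_trans (nrmM _ _) _.
    by rewrite ler_piMl ?nrm_ge0 ?cpow_nrm.
  rewrite (_ : ip _ _ = ip (iter m (cstar_mul h) b) (iter m.+2 (cstar_mul h) b)).
    rewrite -!hn_sqr -exprMn -[_ ^+ 2]real_normK ?num_real //.
    by rewrite ler_pXn2r ?nnegrE ?mulr_ge0 ?hn_ge0 ?ip_CS.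
  by rewrite {1}iterS ipMl hh -iterS.
have hb' : hn (h ** b) <= hn b by rewrite hn_le.
rewrite hn_le ipMl cstar_mulA -/h; apply: le_trans (ip_le _ _) _.
by rewrite -hn_sqr expr2 ler_wpM2l ?hn_ge0.
Qed.

Lemma hnM a b : hn (a ** b) <= nrm a * hn b.
Proof.
have [/nrm0P a0|an0] := eqVneq (nrm a) 0.
  by rewrite a0 cstar_0mul hn0 mulr_ge0 ?nrm_ge0 ?hn_ge0.
have ap : 0 < nrm a by rewrite lt0r an0 nrm_ge0.
have n1 : nrm ((nrm a)^-1%:C%C *: a) <= 1.
  by rewrite nrmZ normcR ger0_norm ?invr_ge0 ?nrm_ge0 // mulVf.
have := contraction_hn b n1.
by rewrite cstar_mulZl hnZ normcR ger0_norm ?invr_ge0 ?nrm_ge0 // ler_pdivrMl.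
Qed.

(** The Gram matrix [G] of a basis is invertible because the form is definite; so coordinates are
    combinations of the [tau ((e k)^# ** b)], which Cauchy-Schwarz bounds by [hn b]. *)
Lemma seminorm_bounded (p : A -> R) : (forall a, 0 <= p a) ->
  (forall a b, p (a + b) <= p a + p b) ->
  (forall z a, p (z *: a) = normc z * p a) ->
  exists2 K, 0 <= K & forall b, p b <= K * hn b.
Proof.
move=> p0 pD pZ; pose e i := r2v (delta_mx 0 i).
pose G := \matrix_(i, j) tau ((e j)^# ** e i).
have bE b : b = \sum_i v2r b 0 i *: e i.
  rewrite -[LHS]v2rK {1}[v2r b]row_sum_delta linear_sum /=.
  by apply: eq_bigr => i _; rewrite linearZ.
have GE b j : (v2r b *m G) 0 j = tau ((e j)^# ** b).
  rewrite {2}[b]bE linear_sum raddf_sum mxE; apply: eq_bigr => i _.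
  by rewrite mxE /= cstar_mulZr tauZ.
have Gu : G \in unitmx.
  rewrite -row_free_unit; apply: inj_row_free => u uG.
  have e0 j : tau ((r2v u)^# ** e j) = 0.
    rewrite -[_ ** _]cstar_adjK tau_adj // cstar_adjM cstar_adjK -GE r2vK uG mxE.
    exact: conjC0.
  suff u0 : r2v u = 0 by rewrite -[u]r2vK u0 linear0.
  apply: (@tau_adjM_eq0 _ _ cs); rewrite {2}[r2v u]bE linear_sum raddf_sum.
  by rewrite big1 // => i _; rewrite /= cstar_mulZr tauZ // e0 mulr0.
pose D i k := invmx G k i.
have cE b i : v2r b 0 i = \sum_k tau ((e k)^# ** b) * D i k.
  rewrite -[v2r b](mulmxK Gu) mxE; apply: eq_bigr => k _; by rewrite GE.
have tb b k : normc (tau ((e k)^# ** b)) <= 2 * hn (e k) * hn b.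
  have -> : tau ((e k)^# ** b) = (ip b (e k))%:C%C + 'i%C * (- ip ('i%C *: b) (e k))%:C%C.
    rewrite {1}[tau _]complexE /ip; congr (_ + 'i%C * (_)%:C%C).
    by rewrite cstar_mulZr tauZ //; case: (tau _) => x y /=; ring.
  apply: le_trans (le_normcD _ _) _; rewrite ComplexField.Normc.normcM.
  rewrite normcR [normc 'i%C]/= expr0n expr1n add0r sqrtr1 mul1r normcR normrN.
  have := ip_CS b (e k); have := ip_CS ('i%C *: b) (e k).
  rewrite hnZ [normc 'i%C]/= expr0n expr1n add0r sqrtr1 mul1r; lra.
have psum (I : Type) (s : seq I) (F : I -> A) :
    p (\sum_(i <- s) F i) <= \sum_(i <- s) p (F i).
  elim/big_rec2: _ => [|i x y _ IH]; last by apply: le_trans (pD _ _) _; rewrite lerD2l.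
  by rewrite -(scale0r 0) pZ normcR normr0 mul0r.
exists (\sum_i (\sum_k (2 * hn (e k)) * normc (D i k)) * p (e i)).
  apply: sumr_ge0 => i _; rewrite mulr_ge0 //; apply: sumr_ge0 => k _.
  by rewrite !mulr_ge0 ?hn_ge0 ?normc_ge0.
move=> b; rewrite {1}[b]bE. apply: (le_trans (psum _ _ _)).
rewrite mulr_suml; apply: ler_sum => i _.
rewrite pZ mulrAC ler_wpM2r // cE; apply: le_trans (normc_sum _ _) _.
rewrite mulr_suml; apply: ler_sum => k _.
by rewrite ComplexField.Normc.normcM mulrAC ler_wpM2r ?normc_ge0.
Qed.

(** Converse of [contraction_hn]. The adjoint is a contraction too, so the powers of [h = a^# ** a]
    are bounded in [hn], hence in [nrm]. The C*-identity makes [nrm h^m] log-convex, whence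
    [nrm a ^+ 4 <= nrm a ^+ 2]. *)
Lemma hn_contraction a : (forall b, hn (a ** b) <= hn b) -> nrm a <= 1.
Proof.
move=> a1.
have [K K0 KP] : exists2 K, 0 <= K & forall b : A, nrm b <= K * hn b.
  apply: seminorm_bounded; [exact: nrm_ge0|exact: nrmD|exact: nrmZ].
have a2 b : hn (a^# ** b) <= hn b.
  have [->|b0] := eqVneq (hn (a^# ** b)) 0; first exact: hn_ge0.
  rewrite -(ler_pM2l (_ : 0 < hn (a^# ** b))) ?lt0r ?b0 ?hn_ge0 //.
  rewrite -expr2 hn_sqr ipMl cstar_adjK ipC; apply: le_trans (ip_le _ _) _.
  by rewrite mulrC [leRHS]mulrC ler_wpM2l ?hn_ge0.
pose h := a^# ** a.
have hh : h^# = h by rewrite cstar_adjM cstar_adjK.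
have h1 m : hn (cpow h m) <= hn h.
  elim: m => [|m IH] //; apply: le_trans IH.
  by rewrite /cpow iterS -/(cpow h m) -cstar_mulA; apply: le_trans (a2 _) (a1 _).
have : nrm (cpow h 1) <= nrm (cpow h 0).
  apply: (@logconvex_bounded _ (fun m => nrm (cpow h m)) (K * hn h)) => m.
  - exact: nrm_ge0.
  - by apply: le_trans (KP _) _; rewrite ler_wpM2l.
  by rewrite -nrm_sqr ?cpow_adj // cpowM addSnnS -cpowM nrmM.
rewrite /cpow /= nrm_sqr // nrm_adjM => h2.
rewrite -(@expr_le1 _ 2) ?nrm_ge0 //.
have [->|an] := eqVneq (nrm a) 0; first by rewrite expr0n.
have ap : 0 < nrm a ^+ 2 by rewrite exprn_gt0 // lt0r an nrm_ge0.
by move: (nrm a ^+ 2) ap h2 => x x0; rewrite expr2 ger_pMl.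
Qed.

End InnerProduct.

(** * Defect operators *)

Section Defect.
Variables (R : realType) (A : cstarAlgType R) (cs : coordinates A).
Local Notation C := R[i].
Local Notation ip := (ip cs).
Local Notation hn := (hn cs).
Implicit Types (a b c d u w x y : A) (f : {linear A -> A}).

(** The matrices of [f] and [f \o f] have the same rank, hence the same row space and column space:
    one gives equality of ranges, the other a linear map [g] with [f = g \o f \o f]. *)
Lemma linear_index1 f : (forall u, f (f u) = 0 -> f u = 0) ->
  (forall c, exists u, f c = f (f u)) /\
  (exists2 K, 0 <= K & forall u, hn (f u) <= K * hn (f (f u))).
Proof.
move=> f0; pose M := mxof cs f.
have fM b : to_row cs (f b) = to_row cs b *m M by rewrite mul_mxof.
have MM : \rank (M *m M) = \rank M.
  rewrite -[RHS](mxrank_mul_ker M M).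
  suff -> : (M :&: kermx M)%MS = 0 by rewrite mxrank0 addn0.
  apply/eqP/rowV0P => v; rewrite sub_capmx => /andP[/submxP[u ->]] /sub_kermxP.
  rewrite -[u](@of_rowK _ _ cs) -!fM -(linear0 (to_row cs)).
  by move=> /(can_inj (@to_rowK _ _ cs))/f0 ->.
have /submxP[D DM] : (M <= M *m M)%MS.
  by rewrite -(mxrank_leqif_sup (submxMl M M)) MM.
have /submxP[Z ZM] : (M^T <= M^T *m M^T)%MS.
  by rewrite -(mxrank_leqif_sup (submxMl _ _)) -trmx_mul !mxrank_tr MM.
split=> [c|].
  exists (of_row cs (to_row cs c *m D)); apply: (can_inj (@to_rowK _ _ cs)).
  by rewrite !fM of_rowK -!mulmxA -DM.
have {}ZM : M = M *m M *m Z^T.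
  by apply: trmx_inj; rewrite !trmx_mul trmxK.
pose g b := of_row cs (to_row cs b *m Z^T).
have [K K0 KP] := @seminorm_bounded _ _ cs (hn \o g) (fun=> hn_ge0 _ _)
  (fun a b => ltac:(rewrite /= /g linearD mulmxDl linearD; exact: hnD))
  (fun z b => ltac:(rewrite /= /g linearZ -scalemxAl linearZ; exact: hnZ)).
exists K => // u; suff {1}-> : f u = g (f (f u)) by exact: KP.
apply: (can_inj (@to_rowK _ _ cs)).
by rewrite /g of_rowK !fM {1}ZM !mulmxA.
Qed.

(** [Q y] as an operator on [A], since [1] need not exist; [P y] is [defect y^#]. *)
Definition defect y b := b - y^# ** (y ** b).

Lemma defect_linear y : linear (defect y).
Proof.
by move=> k b c; rewrite /defect !(cstar_mulDr, cstar_mulZr) scalerBr opprD addrACA.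
Qed.

HB.instance Definition _ y :=
  @GRing.isLinear.Build C A A *:%R (defect y) (defect_linear y).

Lemma defectM y a b : defect y (a ** b) = defect y a ** b.
Proof. by rewrite /defect cstar_mulBl !cstar_mulA. Qed.

Lemma defect_adjM y u k : (defect y u)^# ** k = u^# ** defect y k.
Proof.
rewrite /defect cstar_adjB !cstar_adjM cstar_adjK cstar_mulBl cstar_mulBr.
by rewrite !cstar_mulA.
Qed.

Lemma mul_defect y b : y ** defect y b = defect y^# (y ** b).
Proof. by rewrite /defect cstar_mulBr cstar_adjK. Qed.

Lemma ip_defect y a b : ip (defect y a) b = ip a b - ip (y ** a) (y ** b).
Proof. by rewrite /defect ipBl ipMl cstar_adjK. Qed.

Lemma ip_defectC y a b : ip (defect y a) b = ip a (defect y b).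
Proof. by rewrite ip_defect [RHS]ipC ip_defect !(ipC _ b) !(ipC _ (y ** b)). Qed.

Lemma defect_defect_eq0 y u : defect y (defect y u) = 0 -> defect y u = 0.
Proof.
by move=> u0; apply: (@ip_eq0 _ _ cs); rewrite ip_defectC u0 ip0r.
Qed.

Lemma defect_index1 y c : exists u, defect y c = defect y (defect y u).
Proof. by have [+ _] := linear_index1 (@defect_defect_eq0 y); exact. Qed.

Lemma defect_coercive y :
  exists2 K, 0 <= K & forall u, hn (defect y u) <= K * hn (defect y (defect y u)).
Proof. by have [] := linear_index1 (@defect_defect_eq0 y). Qed.

(** The range of a symmetric operator is the orthogonal complement of its kernel, and here it is
    also the range of the square. *)
Lemma defect_range y d : (forall k, defect y k = 0 -> d^# ** k = 0) ->
  exists u, d = defect y (defect y u).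
Proof.
move=> dk; have [u uP] := defect_index1 y d; have [u' u'P] := defect_index1 y u.
exists u'; rewrite -u'P; apply/eqP; rewrite -subr_eq0; apply/eqP/(@ip_eq0 _ _ cs).
have k0 : defect y (d - defect y u) = 0 by rewrite linearB /= uP subrr.
rewrite ipBl ip_defectC k0 ip0r subr0 ipC /ip dk //.
by rewrite raddf0.
Qed.

(** Write [d = P (P u)]; then [P u] still kills the kernel of [Q], so its adjoint is [Q (Q v)], and
    [w = (Q v)^#]. The two conditions on [w] normalise it. *)
Lemma defect_factor x d :
  (forall k, defect x k = 0 -> d ** k = 0) ->
  (forall k, defect x^# k = 0 -> d^# ** k = 0) ->
  exists w, [/\ forall k, defect x k = 0 -> w ** k = 0,
    forall k, defect x^# k = 0 -> w^# ** k = 0 &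
    forall b, d ** b = defect x^# (w ** defect x b)].
Proof.
move=> dQ /defect_range[u du].
have [k k0|v vP] := @defect_range x (defect x^# u)^#.
  rewrite cstar_adjK -defectM; apply: defect_defect_eq0.
  by rewrite !defectM -du dQ.
exists (defect x v)^#; split=> [k k0|k k0|b].
- by rewrite defect_adjM k0 cstar_mul0.
- rewrite cstar_adjK -defectM; apply: defect_defect_eq0.
  by rewrite !defectM -vP defect_adjM k0 cstar_mul0.
by rewrite -defect_adjM -vP cstar_adjK !defectM -du.
Qed.

(** Uniqueness of the normalised factor: [w] kills the range of [Q] as well as its kernel, and these
    two span [A]. *)
Lemma defect_factor_eq0 x w :
  (forall k, defect x k = 0 -> w ** k = 0) ->
  (forall k, defect x^# k = 0 -> w^# ** k = 0) ->
  (forall b, defect x^# (w ** defect x b) = 0) -> w = 0.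
Proof.
move=> wQ wP w0; have wQ0 b : w ** defect x b = 0.
  by apply: (@ip_eq0 _ _ cs); rewrite ipMl wP // ip0r.
suff wc c : w ** c = 0.
  by apply: (can_inj (@cstar_adjK _ A)); rewrite cstar_adj0;
    apply: cstar_adjM_eq0; rewrite cstar_adjK wc.
have [u uP] := defect_index1 x c.
rewrite -(subrK (defect x u) c) cstar_mulDr wQ0 addr0 wQ //.
by rewrite linearB /= uP subrr.
Qed.

Section Contraction.
Variable y : A.
Hypothesis y1 : nrm y <= 1.

Lemma defect_ge0 b : 0 <= ip (defect y b) b.
Proof. by rewrite ip_defect subr_ge0 -hn_le contraction_hn. Qed.

Lemma defect_CS a b :
  ip (defect y a) b ^+ 2 <= ip (defect y a) a * ip (defect y b) b.
Proof.
apply: (quadratic_discr (defect_ge0 b)) => t.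
have := defect_ge0 (a + t%:C%C *: b).
rewrite linearD linearZ /= ipDl !ipDr !ipZl !ipZr (ip_defectC y b a) (ipC _ b); lra.
Qed.

(** This is [Q^2 <= Q]: by [y Q = P y], the difference is the form of [P] at [y ** b]. *)
Lemma hn_defect_sqr b : hn (defect y b) ^+ 2 <= ip (defect y b) b.
Proof.
have e : b - defect y b = y^# ** (y ** b) by rewrite /defect opprB addrC subrK.
rewrite hn_sqr -subr_ge0 -ipBr e ipMr cstar_adjK mul_defect.
by rewrite ip_defect subr_ge0 -hn_le contraction_hn // nrm_adj.
Qed.

Lemma hn_defect b : hn (defect y b) <= hn b.
Proof.
have [->|b0] := eqVneq (hn (defect y b)) 0; first exact: hn_ge0.
rewrite -(ler_pM2l (_ : 0 < hn (defect y b))) ?lt0r ?b0 ?hn_ge0 //.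
by rewrite -expr2; apply: le_trans (hn_defect_sqr _) (ip_le _ _ _).
Qed.

End Contraction.

(** The element [P y w Q y], multiplied out so that no unit occurs. *)
Definition bump y w := defect y^# w - (defect y^# w ** y^#) ** y.

Lemma bumpE y w b : bump y w ** b = defect y^# (w ** defect y b).
Proof.
by rewrite defectM [defect y b]/defect cstar_mulBr /bump cstar_mulBl !cstar_mulA.
Qed.

Lemma defect_near x y u (e : R) : nrm x <= 1 -> nrm y <= 1 -> nrm (y - x) <= e ->
  hn (defect y u) <= hn (defect x u) + 2 * e * hn u.
Proof.
move=> x1 y1 yx; have e0 : 0 <= e by apply: le_trans yx; exact: nrm_ge0.
have -> : defect y u = defect x u - (x^# ** ((y - x) ** u) + (y - x)^# ** (y ** u)).
  rewrite /defect cstar_adjB !cstar_mulBl cstar_mulBr.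
  by rewrite (addrC (x^# ** _ - _)) subrKA opprB addrA subrK.
apply: le_trans (hnD _ _ _) _; rewrite hnN lerD2l.
apply: le_trans (hnD _ _ _) _.
have h1 : hn (x^# ** ((y - x) ** u)) <= e * hn u.
  apply: le_trans (contraction_hn _ _ _) _; first by rewrite nrm_adj.
  by apply: le_trans (hnM _ _ _) _; rewrite ler_wpM2r ?hn_ge0.
have h2 : hn ((y - x)^# ** (y ** u)) <= e * hn u.
  apply: le_trans (hnM _ _ _) _; rewrite nrm_adj ler_pM ?nrm_ge0 ?hn_ge0 //.
  exact: contraction_hn.
lra.
Qed.

(* The vector [c = defect y b] is split as [c = c' + v] with [c' = defect x b'],
   [b'] in the range of [defect x] and [v] in its kernel. The hypothesis on
   [x + d] is used at [b'], and Cauchy-Schwarz for the form of [defect y]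
   compares [ip c' b'] with [ip c b]; this comparison is insensitive to
   [defect y] being nearly singular. *)
Lemma bump_contraction x d w (s : R) :
  nrm x <= 1 -> nrm (x + d) <= 1 -> 0 < s < 1 ->
  (forall k, defect x k = 0 -> w ** k = 0) ->
  (forall k, defect x^# k = 0 -> w^# ** k = 0) ->
  (forall b, d ** b = defect x^# (w ** defect x b)) ->
  exists2 e : R, 0 < e & forall y, nrm y <= 1 -> nrm (y - x) <= e ->
    nrm (y + s%:C%C *: bump y w) <= 1.
Proof.
move=> x1 xd1 /andP[s0 s1] wQ wP dE; have [K K0 KP] := defect_coercive x.
pose W := nrm w; have W0 : 0 <= W := nrm_ge0 w.
(* The three terms collect the errors of [beta2], [cross] and [sqr] below. *)
pose D := 2 * K ^+ 2 + 2 * W + 4 * W ^+ 2.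
have D0 : 0 <= D by rewrite !addr_ge0 ?mulr_ge0 ?sqr_ge0.
pose e := (1 - s) / (D + 1).
have e0 : 0 < e by rewrite divr_gt0 ?subr_gt0 // ltr_wpDl.
have eD : e * D <= 1 - s.
  by rewrite /e mulrAC ler_pdivrMr ?ltr_wpDl //; nra.
exists e => // y y1 yx; apply: (@hn_contraction _ _ cs) => b.
pose c := defect y b.
have [u uP] := defect_index1 x c; have [u' u'P] := defect_index1 x u.
pose b' := defect x u'; pose c' := defect x b'.
have v0 : defect x (c - c') = 0 by rewrite linearB /= uP u'P subrr.
have wc : w ** c = w ** c'.
  by apply/eqP; rewrite -subr_eq0 -cstar_mulBr wQ.
pose beta := ip c' b'; pose gamma := ip c b.
have cb : ip c b' = beta.
  by apply/eqP; rewrite -subr_eq0 -ipBl -ip_defectC v0 ip0l.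
have gamma0 : 0 <= gamma by exact: defect_ge0.
have beta0 : 0 <= beta by exact: defect_ge0.
have c_gamma : hn c ^+ 2 <= gamma by exact: hn_defect_sqr.
have wcc : hn (w ** c) <= W * hn c by exact: hnM.
(* This is [|(x + d) b'|^2 <= |b'|^2] expanded, with [x Q = P x] in the cross term. *)
have beta1 : 2 * ip (x ** c) (w ** c) + hn (defect x^# (w ** c)) ^+ 2 <= beta.
  have -> : ip (x ** c) (w ** c) = ip (x ** c') (w ** c').
    apply/eqP; rewrite -wc -subr_eq0 -ipBl -cstar_mulBr ipMr wP ?ip0l //.
    by rewrite -mul_defect v0 cstar_mul0.
  have e1 : ip (x ** b') (defect x^# (w ** c')) = ip (x ** c') (w ** c').
    by rewrite -ip_defectC -mul_defect.
  have e2 : beta = ip b' b' - ip (x ** b') (x ** b') by rewrite /beta ip_defect.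
  have := contraction_hn cs b' xd1; rewrite hn_le cstar_mulDl dE -/c'.
  rewrite ip_sqrD e1 hn_sqr wc e2; lra.
have bK : hn b' ^+ 2 <= K ^+ 2 * beta.
  apply: (@le_trans _ _ ((K * hn c') ^+ 2)).
    by rewrite ler_pXn2r ?nnegrE ?mulr_ge0 ?hn_ge0 ?KP.
  by rewrite exprMn ler_wpM2l ?sqr_ge0 // hn_defect_sqr.
(* Cauchy-Schwarz gives [beta^2 <= gamma <defect y b', b'>]; the last factor is at most
   [beta (1 + 2 e K^2)], and [beta] cancels. *)
have beta2 : beta <= gamma * (1 + 2 * e * K ^+ 2).
  have h1 : beta ^+ 2 <= gamma * ip (defect y b') b' by rewrite -cb defect_CS.
  have h2 : ip (defect y b') b' <= beta + 2 * e * hn b' ^+ 2.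
    rewrite /beta /c' !ip_defect.
    have h3 : hn (x ** b') <= hn (y ** b') + e * hn b'.
      rewrite -[x](subKr y) cstar_mulBl; apply: le_trans (hnD _ _ _) _.
      rewrite hnN lerD2l; apply: le_trans (hnM _ _ _) _.
      by rewrite ler_wpM2r ?hn_ge0.
    have := sqr_near (hn_ge0 _ _) (hn_ge0 _ _) (contraction_hn cs b' x1)
      (contraction_hn cs b' y1) (mulr_ge0 (ltW e0) (hn_ge0 _ _)) h3.
    by rewrite -!(hn_sqr cs); lra.
  have k0 : 0 <= 2 * e by rewrite mulr_ge0 // ltW.
  have [->|bn0] := eqVneq beta 0.
    by rewrite mulr_ge0 // addr_ge0 // mulr_ge0 // sqr_ge0.
  have bp : 0 < beta by rewrite lt0r bn0.
  rewrite -(ler_pM2l bp) -expr2; apply: le_trans h1 _.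
  rewrite mulrCA ler_wpM2l //; apply: le_trans h2 _.
  rewrite mulrDr mulr1 lerD2l; apply: le_trans (ler_wpM2l k0 bK) _.
  by rewrite mulrA mulrC.
have cross : ip (y ** c) (w ** c) <= ip (x ** c) (w ** c) + e * W * hn c ^+ 2.
  rewrite -{1}[y](subrK x) cstar_mulDl ipDl addrC lerD2l.
  apply: le_trans (ip_le _ _ _) _; rewrite expr2 mulrACA.
  by rewrite ler_pM ?hn_ge0 //; apply: le_trans (hnM _ _ _) _; rewrite ler_wpM2r ?hn_ge0.
have sqr : hn (defect y^# (w ** c)) ^+ 2 <=
    hn (defect x^# (w ** c)) ^+ 2 + 4 * e * W ^+ 2 * hn c ^+ 2.
  have h1 : hn (defect y^# (w ** c)) <= hn (defect x^# (w ** c)) + 2 * e * hn (w ** c).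
    by apply: defect_near; rewrite ?nrm_adj // -cstar_adjB nrm_adj.
  have h2 : hn (defect y^# (w ** c)) <= hn (w ** c) by rewrite hn_defect ?nrm_adj.
  have h3 : hn (defect x^# (w ** c)) <= hn (w ** c) by rewrite hn_defect ?nrm_adj.
  have h4 : hn (w ** c) ^+ 2 <= W ^+ 2 * hn c ^+ 2.
    by rewrite -exprMn ler_pXn2r ?nnegrE ?mulr_ge0 ?hn_ge0.
  have := sqr_near (hn_ge0 _ _) (hn_ge0 _ _) h2 h3
    (mulr_ge0 (mulr_ge0 (ler0n _ 2) (ltW e0)) (hn_ge0 _ _)) h1.
  have : 4 * e * hn (w ** c) ^+ 2 <= 4 * e * (W ^+ 2 * hn c ^+ 2).
    by rewrite ler_wpM2l // mulr_ge0 // ltW.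
  lra.
have yb : hn ((y + s%:C%C *: bump y w) ** b) ^+ 2 = ip b b - gamma +
    (2 * s * ip (y ** c) (w ** c) + s ^+ 2 * hn (defect y^# (w ** c)) ^+ 2).
  rewrite !hn_sqr cstar_mulDl cstar_mulZl bumpE -/c ip_sqrD !ipZr ipZl.
  have -> : gamma = ip b b - ip (y ** b) (y ** b) by exact: ip_defect.
  by rewrite -(ip_defectC y^# (y ** b)) -mul_defect -/c; ring.
rewrite hn_le -!(hn_sqr cs) yb -(hn_sqr cs).
have := sqr_ge0 (hn (defect y^# (w ** c))).
move: (hn (defect y^# _) ^+ 2) (hn (defect x^# _) ^+ 2) (ip (y ** c) _) (ip (x ** c) _)
  beta1 beta2 cross sqr => p q r t beta1 beta2 cross sqr p0.
have sp : 0 <= s * (1 - s) * p by rewrite !mulr_ge0 ?subr_ge0 // ltW.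
(* Here [s^2 p] is replaced by the larger [s p]. *)
suff : s * (2 * r + p) <= gamma by lra.
have eg : 0 <= e * (gamma - hn c ^+ 2) * (2 * W + 4 * W ^+ 2).
  apply: mulr_ge0; first by rewrite mulr_ge0 ?subr_ge0 // ltW.
  by rewrite addr_ge0 ?mulr_ge0 ?sqr_ge0.
have h : 2 * r + p <= gamma * (1 + e * D) by rewrite /D; lra.
apply: (@le_trans _ _ (s * (gamma * (1 + e * D)))); first by rewrite ler_pM2l.
(* From [e D <= 1 - s] and [s (2 - s) = 1 - (1 - s)^2]. *)
have h' : s * (1 + e * D) <= 1.
  have : 0 <= (1 - s) * (1 - s) by rewrite -expr2 sqr_ge0.
  have : s * (e * D) <= s * (1 - s) by rewrite ler_pM2l.
  lra.
by rewrite mulrCA ler_piMr.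
Qed.

End Defect.

(** * Convex combinations *)

Section ConvexCombination.
Variables (R : realType) (A : cstarAlgType R) (cs : coordinates A).
Local Notation C := R[i].
Local Notation ip := (ip cs).
Implicit Types a b c d u w y z : A.

Lemma cstar_sum_mul (I : Type) (r : seq I) (F : I -> A) b :
  (\sum_(i <- r) F i) ** b = \sum_(i <- r) F i ** b.
Proof.
by apply: (big_morph (fun a => a ** b)) => [a c|]; rewrite ?cstar_mulDl ?cstar_0mul.
Qed.

Lemma cstar_adj_sum (I : Type) (r : seq I) (F : I -> A) :
  (\sum_(i <- r) F i)^# = \sum_(i <- r) (F i)^#.
Proof.
by apply: (big_morph (@cstar_adj R A)) => [a b|]; rewrite ?cstar_adjD ?cstar_adj0.
Qed.

(** Without a unit, the test element is [(a - b)^#]. *)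
Lemma cstar_mul_inj a b : (forall c, a ** c = b ** c) -> a = b.
Proof.
move=> ab; apply/eqP; rewrite -subr_eq0; apply/eqP.
apply: (can_inj (@cstar_adjK R A)); rewrite cstar_adj0; apply: cstar_adjM_eq0.
by rewrite cstar_adjK cstar_mulBl ab subrr.
Qed.

Lemma nrm_sum (I : Type) (r : seq I) (F : I -> A) :
  nrm (\sum_(i <- r) F i) <= \sum_(i <- r) nrm (F i).
Proof.
elim/big_rec2: _ => [|i x y _ h]; first by rewrite /nrm normr0.
by apply: le_trans (nrmD _ _) _; rewrite lerD2l.
Qed.

Lemma ip_suml (I : Type) (r : seq I) (F : I -> A) b :
  ip (\sum_(i <- r) F i) b = \sum_(i <- r) ip (F i) b.
Proof.
by apply: (big_morph (fun a => ip a b)) => [a c|]; rewrite ?ipDl ?ip0l.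
Qed.

Section Weights.
Variables (m : nat) (l : 'I_m -> R) (x : 'I_m -> A).
Hypotheses (l0 : forall i, 0 < l i) (l1 : \sum_i l i = 1).
Hypothesis x1 : forall i, nrm (x i) <= 1.
Local Notation x0 := (\sum_i (l i)%:C%C *: x i).

Lemma nrm_convex : nrm x0 <= 1.
Proof.
apply: le_trans (nrm_sum _ _) _; rewrite -l1; apply: ler_sum => i _.
by rewrite nrmZ normcR gtr0_norm // ler_piMr // ltW.
Qed.

(* Strict convexity of the Hilbert norm, on the space where [x0] is isometric. *)
Lemma convex_defect_eq0 i k : defect x0 k = 0 -> (x i - x0) ** k = 0.
Proof.
move=> k0; pose z j := (x j - x0) ** k.
have x0k : \sum_j (l j)%:C%C *: (x j ** k) = x0 ** k.
  by rewrite cstar_sum_mul; apply: eq_bigr => j _; rewrite cstar_mulZl.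
have kk : ip k k = ip (x0 ** k) (x0 ** k).
  by apply/eqP; rewrite -subr_eq0 -ip_defect k0 ip0l.
have zz j : ip (z j) (z j) = ip (x j ** k) (x j ** k)
    - 2 * ip (x j ** k) (x0 ** k) + ip (x0 ** k) (x0 ** k).
  rewrite /z cstar_mulBl ip_sqrD ipNl !ipNr; ring.
(* The variance equals [sum l_j |x_j k|^2 - |x0 k|^2], at most [|k|^2 - |x0 k|^2 = 0]. *)
have s0 : \sum_j l j * ip (z j) (z j) <= 0.
  apply: (@le_trans _ _ (\sum_j (l j * (ip k k + ip k k)
      - 2 * ip ((l j)%:C%C *: (x j ** k)) (x0 ** k)))).
    apply: ler_sum => j _; rewrite zz ipZl -kk.
    have : 0 <= l j * (ip k k - ip (x j ** k) (x j ** k)).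
      by rewrite mulr_ge0 ?(ltW (l0 j)) // subr_ge0 -hn_le contraction_hn.
    lra.
  rewrite sumrB -mulr_suml l1 -mulr_sumr -ip_suml x0k -kk; lra.
have lz j : 0 <= l j * ip (z j) (z j) by rewrite mulr_ge0 ?ip_ge0 // ltW.
have s00 : \sum_j l j * ip (z j) (z j) = 0.
  by apply/eqP; rewrite eq_le s0 sumr_ge0 // => j _; exact: lz.
have /(_ i isT)/eqP := psumr_eq0P (fun j _ => lz j) s00.
by rewrite mulf_eq0 gt_eqF //= => /eqP/ip_eq0.
Qed.

End Weights.

Lemma bump_linear y : linear (bump y).
Proof.
move=> k u w; rewrite /bump linearP /=; move: (defect _ u) (defect _ w) => a b.
by rewrite !(cstar_mulDl, cstar_mulZl) scalerBr opprD addrACA.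
Qed.

HB.instance Definition _ y :=
  @GRing.isLinear.Build C A A *:%R (bump y) (bump_linear y).

(** Boundedness is included to make the class stable under products, so that it contains the
    polynomials in [y] and [y^#]. *)
Definition ball_lip (f : A -> A) := exists2 K : R, 0 <= K &
  forall y, nrm y <= 1 -> nrm (f y) <= K /\
    forall z, nrm z <= 1 -> nrm (f y - f z) <= K * nrm (y - z).

Lemma ball_lip_id : ball_lip id.
Proof. by exists 1 => // y y1; split=> // z _; rewrite mul1r. Qed.

Lemma ball_lip_cst a : ball_lip (fun=> a).
Proof.
exists (nrm a); first exact: nrm_ge0.
move=> y _; split=> // z _; rewrite subrr {1}/nrm normr0.
by rewrite mulr_ge0 ?nrm_ge0.
Qed.

Lemma ball_lipD f g : ball_lip f -> ball_lip g -> ball_lip (fun y => f y + g y).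
Proof.
move=> [K K0 KP] [L L0 LP]; exists (K + L); first exact: addr_ge0.
move=> y y1; have [f1 f2] := KP _ y1; have [g1 g2] := LP _ y1; split=> [|z z1].
  by apply: le_trans (nrmD _ _) _; exact: lerD.
rewrite opprD addrACA mulrDl; apply: le_trans (nrmD _ _) _.
by apply: lerD; [exact: f2|exact: g2].
Qed.

Lemma ball_lipZ k f : ball_lip f -> ball_lip (fun y => k *: f y).
Proof.
move=> [K K0 KP]; exists (normc k * K); first by rewrite mulr_ge0 ?normc_ge0.
move=> y y1; have [f1 f2] := KP _ y1; split=> [|z z1].
  by rewrite nrmZ ler_wpM2l ?normc_ge0.
by rewrite -scalerBr nrmZ -mulrA ler_wpM2l ?normc_ge0 ?f2.
Qed.

Lemma ball_lipN f : ball_lip f -> ball_lip (fun y => - f y).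
Proof.
move=> [K K0 KP]; exists K => // y /KP[f1 f2]; split=> [|z /f2]; first by rewrite nrmN.
by rewrite -opprD nrmN.
Qed.

Lemma ball_lip_adj f : ball_lip f -> ball_lip (fun y => (f y)^#).
Proof.
move=> [K K0 KP]; exists K => // y /KP[f1 f2]; split=> [|z /f2]; first by rewrite nrm_adj.
by rewrite -cstar_adjB nrm_adj.
Qed.

Lemma ball_lipM f g : ball_lip f -> ball_lip g -> ball_lip (fun y => f y ** g y).
Proof.
move=> [K K0 KP] [L L0 LP]; exists (2 * (K * L)); first by rewrite !mulr_ge0.
move=> y y1; have [f1 f2] := KP _ y1; have [g1 g2] := LP _ y1; split=> [|z z1].
  apply: le_trans (nrmM _ _) _; apply: (@le_trans _ _ (K * L)).
    by rewrite ler_pM ?nrm_ge0.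
  by rewrite mulrDl mul1r lerDl mulr_ge0.
have [f3 _] := KP _ z1.
rewrite (_ : _ - _ = (f y - f z) ** g y + f z ** (g y - g z)); last first.
  by rewrite cstar_mulBl cstar_mulBr subrKA.
apply: le_trans (nrmD _ _) _.
have h1 : nrm ((f y - f z) ** g y) <= (K * nrm (y - z)) * L.
  by apply: le_trans (nrmM _ _) _; rewrite ler_pM ?nrm_ge0 // f2.
have h2 : nrm (f z ** (g y - g z)) <= K * (L * nrm (y - z)).
  by apply: le_trans (nrmM _ _) _; rewrite ler_pM ?nrm_ge0 // g2.
lra.
Qed.

Lemma ball_lip_bump w : ball_lip (fun y => bump y w).
Proof.
have id := ball_lip_id; have adj := ball_lip_adj id.
have def : ball_lip (fun y => defect y^# w).
  rewrite /defect; apply: ball_lipD (ball_lip_cst _) _; apply: ball_lipN.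
  by apply: ball_lipM (ball_lipM _ (ball_lip_cst w)); first exact: ball_lip_adj.
rewrite /bump; apply: ball_lipD => //; apply: ball_lipN.
exact: ball_lipM (ball_lipM def adj) id.
Qed.

Lemma unit_ballE a : unit_ball A a = (nrm a <= 1) :> Prop.
Proof. by rewrite /unit_ball /mkset nrmE -lecR. Qed.

Lemma ball_nrm a b (r : R) : ball a r%:C%C b = (nrm (b - a) < r) :> Prop.
Proof. by rewrite -ball_normE /ball_ /mkset distrC nrmE ltcR. Qed.

Lemma ball_lip_continuous (D : set A) f : D `<=` unit_ball A ->
  ball_lip f -> {within D, continuous f}.
Proof.
move=> D1 [K K0 KP]; apply/subspace_continuousP => y Dy.
have y1 : nrm y <= 1 by rewrite -unit_ballE; exact: D1.
apply/cvgrPdist_lt => e e0.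
have eE : e = (Re e)%:C%C.
  by move: e0; case: (e) => p q; rewrite ltcE /= => /andP[/eqP -> _].
have r0 : 0 < Re e by rewrite -ltcR -eE.
rewrite /prop_near1 nbhs_simpl /within /=.
(* [K + 1] because [K] may be 0. *)
apply/nbhs_ballP; exists (Re e / (K + 1))%:C%C.
  by rewrite /= ltcR divr_gt0 // ltr_wpDl.
move=> z yz Dz /=; rewrite eE nrmE ltcR.
have z1 : nrm z <= 1 by rewrite -unit_ballE; exact: D1.
have [_ /(_ z z1) h] := KP _ y1; apply: le_lt_trans h _.
move: yz; rewrite ball_nrm ltr_pdivlMr ?ltr_wpDl // -nrmN opprB.
by have := nrm_ge0 (y - z); nra.
Qed.

End ConvexCombination.

(** * Construction of the maps [Phi] *)

Lemma coordinates_finite_dimensional (R : realType) (A : cstarAlgType R) :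
  finite_dimensional A -> inhabited (coordinates A).
Proof.
move=> [n [[f flin [g fK gK]]]].
pose fl : {linear A -> 'rV[R[i]]_n} := HB.pack f (GRing.isLinear.Build _ _ _ _ f flin).
have glin : linear g.
  by move=> k u v; apply: (can_inj fK); rewrite gK [RHS]flin !gK.
pose gl : {linear 'rV[R[i]]_n -> A} := HB.pack g (GRing.isLinear.Build _ _ _ _ g glin).
by constructor; exists n fl gl.
Qed.

(** The witness [1 / (1 + sum 1 / e_i)] also serves the empty family. *)
Lemma uniform_lower_bound (R : realType) (m : nat) (e : 'I_m -> R) :
  (forall i, 0 < e i) -> exists2 r, 0 < r & forall i, r <= e i.
Proof.
move=> e0; have s0 : 0 <= \sum_i (e i)^-1 by apply: sumr_ge0 => i _; rewrite invr_ge0 ltW.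
exists (1 + \sum_i (e i)^-1)^-1 => [|i]; first by rewrite invr_gt0 ltr_wpDr.
rewrite -[leRHS]invrK lef_pV2 ?posrE ?invr_gt0 ?ltr_wpDr //.
rewrite (bigD1 i) //= addrCA lerDl addr_ge0 // sumr_ge0 // => j _.
by rewrite invr_ge0 ltW.
Qed.

Theorem theorem3p8 (R : realType) (A : cstarAlgType R)
    (hA : finite_dimensional A) :
  property_co A.
Proof.
have [cs] := coordinates_finite_dimensional hA.
move=> n x lambda eps x1 l_gt0 l_sum eps_gt0 x0.
have posE (z : R[i]) : 0 < z -> z = (Re z)%:C%C /\ 0 < Re z.
  by case: z => p q; rewrite ltcE /= => /andP[/eqP -> ->].
pose l i := Re (lambda i).
have lE i : lambda i = (l i)%:C%C by have [] := posE _ (l_gt0 i).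
have {}l_gt0 i : 0 < l i by have [] := posE _ (l_gt0 i).
have l1 : \sum_i l i = 1.
  by apply: complexI; rewrite rmorph_sum -[RHS]l_sum; apply: eq_bigr => i _; rewrite lE.
have {}x1 i : nrm (x i) <= 1 by rewrite -unit_ballE; exact: x1.
have x0E : x0 = \sum_i (l i)%:C%C *: x i by apply: eq_bigr => i _; rewrite lE.
have x01 : nrm x0 <= 1 by rewrite x0E nrm_convex.
have [epsE e0] := posE _ eps_gt0; set e := Re eps in epsE e0.
pose d i := x i - x0.
have factor i : exists w, [/\ forall k, defect x0 k = 0 -> w ** k = 0,
    forall k, defect x0^# k = 0 -> w^# ** k = 0 &
    forall b, d i ** b = defect x0^# (w ** defect x0 b)].
  apply: (defect_factor cs) => k k0; rewrite /d.
    by move: k0; rewrite x0E; exact: (convex_defect_eq0 cs).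
  (* As the weights are real, strict convexity applies to the adjoints too. *)
  have x0adj : x0^# = \sum_j (l j)%:C%C *: (x j)^#.
    rewrite x0E cstar_adj_sum; apply: eq_bigr => j _.
    by rewrite cstar_adjZ conj_Creal //; apply/complex_realP; exists (l j).
  move: k0; rewrite cstar_adjB x0adj; apply: (convex_defect_eq0 cs) => //.
  by move=> j; rewrite nrm_adj.
have [w wP] := choice factor.
have wQ i k : defect x0 k = 0 -> w i ** k = 0 by have [h _ _] := wP i; exact: h.
have wA i k : defect x0^# k = 0 -> (w i)^# ** k = 0 by have [_ h _] := wP i; exact: h.
have wE i b : d i ** b = defect x0^# (w i ** defect x0 b) by have [_ _ h] := wP i.
(* The sum inherits the normalisation of the [w i] and factors [sum lambda_i d_i = 0], so uniqueness
   applies. *)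
have w_sum : \sum_i lambda i *: w i = 0.
  apply: (defect_factor_eq0 cs (x := x0)) => [k k0|k k0|b].
  - rewrite cstar_sum_mul big1 // => i _.
    by rewrite cstar_mulZl wQ // scaler0.
  - rewrite cstar_adj_sum cstar_sum_mul big1 // => i _.
    by rewrite cstar_adjZ cstar_mulZl wA // scaler0.
  rewrite cstar_sum_mul linear_sum /=.
  transitivity (\sum_i lambda i *: (d i ** b)).
    by apply: eq_bigr => i _; rewrite cstar_mulZl linearZ /= wE.
  transitivity ((\sum_i lambda i *: d i) ** b).
    by rewrite cstar_sum_mul; apply: eq_bigr => i _; rewrite cstar_mulZl.
  under eq_bigr do rewrite scalerBr.
  by rewrite sumrB -scaler_suml -/x0 l_sum scale1r subrr cstar_0mul.
have e2 : 0 < 1 + e / 2 by rewrite addr_gt0 // divr_gt0.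
(* Chosen so that [1 - s = s e / 2]: since [nrm (d i) <= 2], the point
   [Phi i x0 = x i - (1 - s) d i] is within [s e < e] of [x i]. *)
pose s := (1 + e / 2)^-1.
have s0 : 0 < s by rewrite invr_gt0.
have sE : s + s * (e / 2) = 1 by rewrite -[X in X + _]mulr1 -mulrDr mulVf ?gt_eqF.
have s1 : s < 1 by rewrite -sE ltrDl mulr_gt0 // divr_gt0.
pose Phi i y := y + s%:C%C *: bump y (w i).
have Phi_x0 i : Phi i x0 = x0 + s%:C%C *: d i.
  congr (_ + _ *: _); apply: cstar_mul_inj => b.
  by rewrite bumpE wE.
have lip i : ball_lip (Phi i).
  by apply: ball_lipD (ball_lip_id _) _; apply/ball_lipZ/ball_lip_bump.
have contr i : exists r : R, 0 < r /\ forall y, nrm y <= 1 -> nrm (y - x0) <= r ->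
    nrm (Phi i y) <= 1.
  have [||r r0 rP] := bump_contraction cs (x := x0) (d := d i) (w := w i) (s := s)
    x01 _ _ (wQ i) (wA i) (wE i).
  - by rewrite addrC subrK.
  - by rewrite s0.
  by exists r.
have [r rP] := choice contr.
have lip' i : exists K : R, 0 <= K /\ forall y, nrm y <= 1 ->
    nrm (Phi i y - Phi i x0) <= K * nrm (y - x0).
  by have [K K0 KP] := lip i; exists K; split=> // y y1; have [_ h] := KP _ y1; exact: h.
have [K KP] := choice lip'.
(* The room left for the variation of [Phi i] near [x0]. *)
pose eta := e - s * e.
have eta0 : 0 < eta by rewrite /eta subr_gt0 gtr_pMl.
have [delta delta0 deltaP] : exists2 delta, 0 < delta &
    forall i, delta <= Num.min (r i) (eta / (K i + 1)).
  apply: uniform_lower_bound => i; have [r0 _] := rP i; have [K0 _] := KP i.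
  by rewrite lt_min r0 divr_gt0 // ltr_wpDl.
have inD y : (ball x0 delta%:C%C `&` unit_ball A) y -> nrm (y - x0) < delta /\ nrm y <= 1.
  by case; rewrite ball_nrm unit_ballE.
exists delta%:C%C, Phi; split.
- by rewrite ltcR.
- move=> i; apply: ball_lip_continuous => //; exact: subIsetr.
- move=> i y /inD[yx y1]; have := deltaP i; rewrite le_min => /andP[dr dK].
  have [_ rP'] := rP i; have [K0 KP'] := KP i.
  split; last by rewrite unit_ballE; apply: rP' => //; apply: ltW (lt_le_trans yx dr).
  rewrite epsE ball_nrm.
  rewrite (_ : _ - _ = (Phi i y - Phi i x0) + (s - 1)%:C%C *: d i); last first.
    rewrite -(subrKA (Phi i x0)); congr (_ + _).
    by rewrite Phi_x0 rmorphB rmorph1 scalerBl scale1r addrAC addrC [- d i]opprB.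
  apply: le_lt_trans (nrmD _ _) _.
  have h1 := KP' _ y1.
  have h2 : nrm (Phi i y - Phi i x0) < eta.
    have K1 : 0 < K i + 1 by exact: ltr_wpDl.
    apply: le_lt_trans h1 _; have := lt_le_trans yx dK.
    rewrite (ltr_pdivlMr _ _ K1); have := nrm_ge0 (y - x0).
    move: (nrm (y - x0)) (K i) => N k; rewrite mulrDr mulr1 [k * _]mulrC; lra.
  have h3 : nrm ((s - 1)%:C%C *: d i) <= s * e.
    rewrite nrmZ normcR ler0_norm ?subr_le0 ?(ltW s1) // opprB.
    have : nrm (d i) <= 2.
      by apply: le_trans (nrmD _ _) _; rewrite nrmN; have := x1 i; lra.
    have : 1 - s = s * (e / 2) by rewrite -{1}sE; ring.
    move=> ->; have : 0 < s * (e / 2) by rewrite mulr_gt0 // divr_gt0.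
    nra.
  by rewrite /eta in h2; lra.
move=> y _; rewrite /Phi; under eq_bigr do rewrite scalerDr.
rewrite big_split /= -scaler_suml l_sum scale1r -[LHS]addr0; congr (_ + _); apply/esym.
(* [bump y] is linear in [w], so the corrections average to zero. *)
transitivity (s%:C%C *: bump y (\sum_i lambda i *: w i)); last first.
  by rewrite w_sum linear0 scaler0.
rewrite linear_sum scaler_sumr; apply: eq_bigr => i _.
by rewrite /= [bump y (_ *: _)]linearZ /= !scalerA mulrC.
Qed.
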